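(* Let $F$ be a $4$-regular graph, let $P$ be a circuit partition of $F$, let $D$ be a directed version of $\mathrm{Tch}(P)$, and let $\Gamma$ be an integral cycle basis of $F-E$, where $E\subseteq E(F)$ is based in $F$. Then $\mathrm{CM}(\mathrm{Tch}(P),\pi_P(\Gamma),D)$ is square and has determinant $-1$, $0$, or $1$.
   Context: Graphs: $G=(V,H,E,\epsilon)$ with finite sets of vertices $V$ and half-edges $H$, a partition $E$ of $H$ into unordered pairs (edges), and $\epsilon:H\to V$; loops and multiple edges allowed. $G-E'$ deletes the edges of $E'$. $E'\subseteq E(G)$ is based in $G$ if it contains exactly one edge of each connected component of $G$. A directed version orders each edge as (tail, head). A single transition is an unordered pair of distinct half-edges incident with a common vertex; a directed single transition is such an ordered pair. A closed walk is a sequence $((h_1,h_2),\dots,(h_{n-1},h_n))$ of directed single transitions with $\{h_2,h_3\},\{h_4,h_5\},\dots,\{h_n,h_1\}$ edges, up to cyclic shift. $\sigma(D,W)\in\mathbb Z^{E}$ counts, at each edge, traversals by $W$ along its direction in $D$ minus traversals against it. A circuit is a nonempty closed walk using each half-edge at most once, orientation forgotten. The cycle space of $D$ is the right null space over $\mathbb Q$ of its vertex-edge incidence matrix. A cycle basis is a set $B$ of closed walks such that the $\sigma(D,W)$, $W\in B$, are pairwise distinct and form a basis of the cycle space; it is integral if every $\sigma(D,W)$, $W$ a closed walk, lies in the $\mathbb Z$-span of $\{\sigma(D,W'):W'\in B\}$. $\mathrm{CM}(G,\Gamma,D)$ is the matrix with rows indexed by $\Gamma$ and columns by $E(G)$,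 whose row for $W$ is $\sigma(D,W)$ (rows and columns unordered; the determinant is defined up to sign). $F$ is $4$-regular if every vertex is incident with exactly $4$ half-edges. A transition at $v$ is a partition of the four half-edges at $v$ into two single transitions. A circuit partition $P$ is a set of circuits of $F$ such that every half-edge lies in exactly one single transition of exactly one circuit of $P$; $\tau(P)$ is the set of transitions both of whose single transitions occur in circuits of $P$. The touch-graph $\mathrm{Tch}(P)$ has vertex set $P$, half-edge set the set of single transitions occurring in circuits of $P$, edge set $\tau(P)$, and maps each single transition to the circuit containing it. For a closed walk $W$ of $F$, $\pi_P(W)$ is obtained by replacing each directed single transition $(h,h')$ of $W$ by $(s,s')$, where $s,s'$ are the single transitions of circuits of $P$ containing $h,h'$, and deleting pairs with $s=s'$; it is a closed walk of $\mathrm{Tch}(P)$ in which each remaining $(s,s')$ traverses edge $\{s,s'\}$ from half-edge $s$ to half-edge $s'$. $\pi_P(\Gamma)$ is the multiset $\{\pi_P(W):W\in\Gamma\}$ (rows indexed by $\Gamma$). *)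

(* Defs.v *)
From HB Require Import structures.
From mathcomp Require Import all_boot all_order all_algebra.
Set Implicit Arguments. Unset Strict Implicit. Unset Printing Implicit Defensive.
Import Order.TTheory GRing.Theory Num.Theory.
Local Open Scope ring_scope.

(* A graph (V, H, E, eps): finite vertex type, finite half-edge type, end map,
   and a set of edges (each edge a set of half-edges). *)
Record graph := Graph {
  gV : finType;
  gH : finType;
  gend : gH -> gV;
  gE : {set {set gH}} }.

Definition is_graph (G : graph) : bool :=
  partition (gE G) [set: gH G] && [forall e in gE G, #|e| == 2%N].

Definition gedge (G : graph) : finType := {e : {set gH G} | e \in gE G}.

(* a directed version: choose the tail half-edge of every edge *)
Definition directed_version (G : graph) (D : gedge G -> gH G) : Prop :=
  forall e, D e \in val e.

Definition head (G : graph) (D : gedge G -> gH G) (e : gedge G) : gH G :=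
  odflt (D e) [pick h in val e | h != D e].

Definition dst (G : graph) (h h' : gH G) : bool := (h != h') && (gend h == gend h').

(* the edge traversals of a closed walk ((h1,h2),...,(h_{n-1},h_n)):
   (h2,h3), (h4,h5), ..., (hn,h1) *)
Definition walk_trav (T : Type) (w : seq (T * T)) : seq (T * T) :=
  zip (map snd w) (map fst (rot 1 w)).

Definition is_closed_walk (G : graph) (w : seq (gH G * gH G)) : bool :=
  all (fun p => dst p.1 p.2) w &&
  all (fun p => [set p.1; p.2] \in gE G) (walk_trav w).

Definition sigma_trav (G : graph) (D : gedge G -> gH G) (t : seq (gH G * gH G))
  : 'rV[int]_#|gedge G| :=
  \row_j \sum_(p <- t)
     (([set p.1; p.2] == val (enum_val j))%:R *
      (if p.1 == D (enum_val j) then 1 else -1)).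

Definition sigma (G : graph) (D : gedge G -> gH G) (w : seq (gH G * gH G)) :=
  sigma_trav D (walk_trav w).

Definition incidence (G : graph) (D : gedge G -> gH G) : 'M[rat]_(#|gV G|, #|gedge G|) :=
  \matrix_(i, j) ((gend (head D (enum_val j)) == enum_val i)%:R
                  - (gend (D (enum_val j)) == enum_val i)%:R).

Definition cycle_space (G : graph) (D : gedge G -> gH G) :=
  kermx (incidence D)^T.

Definition sigma_mx (G : graph) (D : gedge G -> gH G) (B : seq (seq (gH G * gH G)))
  : 'M[rat]_(size B, #|gedge G|) :=
  \matrix_(i, j) ((sigma D (nth [::] B i) 0 j)%:~R).

Definition cycle_basis (G : graph) (D : gedge G -> gH G) (B : seq (seq (gH G * gH G))) : Prop :=
  all (@is_closed_walk G) B /\ uniq (map (sigma D) B) /\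
  row_free (sigma_mx D B) /\ (sigma_mx D B == cycle_space D)%MS.

Definition integral_cycle_basis (G : graph) (D : gedge G -> gH G)
  (B : seq (seq (gH G * gH G))) : Prop :=
  cycle_basis D B /\
  forall W : seq (gH G * gH G), is_closed_walk W ->
    exists c : 'I_(size B) -> int,
      sigma D W = \sum_(i < size B) c i *: sigma D (nth [::] B i).

(* CM(G, Gamma, D), Gamma given as a list of edge-traversal lists *)
Definition CM (G : graph) (D : gedge G -> gH G) (rows : seq (seq (gH G * gH G)))
  : 'M[int]_(size rows, #|gedge G|) :=
  \matrix_(i, j) sigma_trav D (nth [::] rows i) 0 j.

Definition square_det_unit (m n : nat) (M : 'M[int]_(m, n)) : Prop :=
  exists sq : m = n, \det (castmx (sq, erefl n) M) \in [:: -1; 0; 1].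

Definition four_regular (F : graph) : Prop :=
  is_graph F /\ forall v : gV F, #|[set h | gend h == v]| = 4%N.

Definition is_circuit (G : graph) (w : seq (gH G * gH G)) : bool :=
  [&& is_closed_walk w, w != [::] & uniq (flatten [seq [:: p.1; p.2] | p <- w])].

(* P given as a list of representatives of its circuits *)
Definition circuit_partition (F : graph) (P : seq (seq (gH F * gH F))) : Prop :=
  all (@is_circuit F) P /\
  forall h : gH F,
    (\sum_(C <- P) count (fun p => (p.1 == h) || (p.2 == h)) C)%N = 1%N.

Definition adj (G : graph) : rel (gV G) := fun u v =>
  [exists e in gE G, exists h in e, exists h' in e,
     [&& h != h', gend h == u & gend h' == v]].

Definition based (G : graph) (E : {set {set gH G}}) : Prop :=
  E \subset gE G /\
  forall v : gV G,
    #|[set e in E | [exists h in e, connect (@adj G) v (gend h)]]| = 1%N.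

Section Minus.
Variables (F : graph) (E : {set {set gH F}}).
Definition minusH : finType := {h : gH F | h \notin cover E}.
Definition FminusE : graph :=
  @Graph (gV F) minusH (fun h => gend (val h))
    [set [set x : minusH | val x \in e] | e : {set gH F} in gE F :\: E].
Definition lift_walk (w : seq (minusH * minusH)) : seq (gH F * gH F) :=
  [seq (val p.1, val p.2) | p <- w].
End Minus.

Section Touch.
Variables (F : graph) (P : seq (seq (gH F * gH F))).

Definition sts (C : seq (gH F * gH F)) : {set {set gH F}} :=
  [set [set p.1; p.2] | p in C].
Definition stP : {set {set gH F}} := \bigcup_(C <- P) sts C.
Definition TchH : finType := {s : {set gH F} | s \in stP}.

Lemma circ_lt (s : TchH) : (find (fun C => val s \in sts C) P < size P)%N.
Proof.
rewrite -has_find; case: s => s /=; rewrite /stP.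
elim: P => [|C Q IH]; first by rewrite big_nil inE.
by rewrite big_cons inE /= => /orP[->|/IH ->] //; rewrite orbT.
Qed.

Definition circ_of (s : TchH) : 'I_(size P) := Ordinal (circ_lt s).

Definition single_tr (s : {set gH F}) : bool :=
  [exists h, exists h', [&& h != h', gend h == gend h' & s == [set h; h']]].

Definition transition_at (v : gV F) (a b : {set gH F}) : bool :=
  [&& single_tr a, single_tr b, a :&: b == set0 & a :|: b == [set h | gend h == v]].

Definition TchE : {set {set TchH}} :=
  [set e | [exists s1 : TchH, exists s2 : TchH,
     (e == [set s1; s2]) && [exists v, transition_at v (val s1) (val s2)]]].

Definition Tch : graph := @Graph 'I_(size P) TchH circ_of TchE.

(* pi_P on a closed walk of F: the list of edge traversals (s,s') of Tch(P) *)
Definition pi_P (W : seq (gH F * gH F)) : seq (gH Tch * gH Tch) :=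
  pmap (fun p : gH F * gH F =>
          match [pick s : TchH | p.1 \in val s], [pick s : TchH | p.2 \in val s] with
          | Some s, Some s' => if s != s' then Some (s, s') else None
          | _, _ => None
          end) W.
End Touch.

(* Main.v *)
Require Import Defs.
From HB Require Import structures.
From mathcomp Require Import all_boot all_order all_algebra.
From mathcomp Require Import zify.
Set Implicit Arguments. Unset Strict Implicit. Unset Printing Implicit Defensive.
Import Order.TTheory GRing.Theory Num.Theory.
Local Open Scope ring_scope.

(* Split every vertex of F into the two single transitions that P uses there.
   The result is a 2-regular graph, whose incidence matrix is totally unimodular,
   and the rows of the vertices of F are the sums of the two rows they split into.
   If a closed walk W enters a vertex v through one single transition and leaves
   through the other, then pi_P(W) traverses the edge v of Tch(P); transits within
   one single transition contribute no net flow.  So the entry of sigma(pi_P(W)) at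
   v is the net flow of sigma(W) into v through one of the single transitions at v,
   whence CM = K M^T, where the rows of K are the sigma(W), W in Gamma, and those
   of M are half of the rows of the split incidence matrix with E deleted.

   As F is 4-regular it has no bridges, so F - E has the components of F, and the
   incidence matrix of F - E minus one row per component is a full-rank matrix N.
   Integral circulations are integer combinations of closed walks, so K is a
   Z-basis of the integral kernel of N.  It extends to a unimodular matrix Q with
   Q [M^T | N^T] block triangular with diagonal blocks K M^T and 1, and
   det [M^T | N^T] is a minor of the split incidence matrix up to row operations. *)

(** * Determinants *)

Lemma sign_mul (a b : int) :
  a \in [:: -1; 0; 1] -> b \in [:: -1; 0; 1] -> a * b \in [:: -1; 0; 1].
Proof. by rewrite !inE => /or3P[]/eqP-> /or3P[]/eqP->. Qed.

(** Induction on [k] by cofactor expansion. When [p j] or [q j] is not a label of any row, column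
    [j] has at most one nonzero entry. Since missing labels are allowed, every square submatrix of a
    directed incidence matrix has this form. *)
Lemma det_network (T : eqType) k (f : 'I_k -> T) (p q : 'I_k -> T) :
  injective f ->
  \det (\matrix_(i, j) ((f i == p j)%:R - (f i == q j)%:R) : 'M[int]_k)
    \in [:: -1; 0; 1].
Proof.
elim: k f p q => [|k IH] f p q injf; first by rewrite det_mx00.
set A := \matrix_(i, j) _.
have minor i j : cofactor A i j \in [:: -1; 0; 1].
  apply: sign_mul; first by rewrite -signr_odd; case: odd.
  have := IH (f \o lift i) (p \o lift j) (q \o lift j)
             (inj_comp injf (@lift_inj _ i)).
  by rewrite (_ : \matrix_(_, _) _ = row' i (col' j A)) //; apply/matrixP=> a b; rewrite !mxE.
have entry i j : A i j \in [:: -1; 0; 1].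
  by rewrite mxE; do 2!case: (_ == _).
have single j i0 : (forall i, i != i0 -> A i j = 0) -> \det A \in [:: -1; 0; 1].
  move=> A0; rewrite (expand_det_col A j) (bigD1 i0) //= big1 ?addr0.
    exact: sign_mul.
  by move=> i /A0->; rewrite mul0r.
case: (boolP [exists j, [forall i, f i != p j]]) => [/existsP[j /forallP fp]|].
  have [/existsP[i0 /eqP fi0]|/existsPn nq] := boolP [exists i, f i == q j].
    apply: (single j i0) => i ii0; rewrite mxE (negPf (fp i)) -fi0.
    by rewrite (inj_eq injf) (negPf ii0) subr0.
  by apply: (single j ord0) => i _; rewrite mxE (negPf (fp i)) (negPf (nq i)) subr0.
move=> /existsPn allp.
case: (boolP [exists j, [forall i, f i != q j]]) => [/existsP[j /forallP fq]|].
  have /forallPn[i0 /negPn/eqP fi0] := allp j.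
  apply: (single j i0) => i ii0; rewrite mxE (negPf (fq i)) -fi0.
  by rewrite (inj_eq injf) (negPf ii0) subr0.
move=> /existsPn allq.
(* Every column has both its entries 1 and -1, so the rows of A sum to 0. *)
have sum1 (r : T) : (exists i, f i = r) -> \sum_i (f i == r)%:R = 1 :> int.
  move=> [i0 <-]; rewrite (bigD1 i0) //= eqxx big1 ?addr0 // => i ii0.
  by rewrite (inj_eq injf) (negPf ii0).
have rows0 : (const_mx 1 : 'rV[int]_k.+1) *m A = 0.
  apply/rowP=> j; rewrite !mxE.
  under eq_bigr do rewrite !mxE mul1r.
  rewrite sumrB !sum1 ?subrr //.
    by have /forallPn[i /negPn/eqP fi] := allq j; exists i.
  by have /forallPn[i /negPn/eqP fi] := allp j; exists i.
suff -> : \det A = 0 by [].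
have : (const_mx 1 : 'rV[int]_k.+1) *m A *m \adj A = 0 by rewrite rows0 mul0mx.
rewrite -mulmxA mul_mx_adj mul_mx_scalar => /rowP/(_ ord0).
by rewrite !mxE mulr1.
Qed.

Lemma row_free_mulmx_inj (r m k : nat) (K : 'M[int]_(r, m)) (A B : 'M[int]_(k, r)) :
  row_free (map_mx intr K : 'M[rat]_(r, m)) -> A *m K = B *m K -> A = B.
Proof.
move=> Kf /(congr1 (map_mx (intr : int -> rat))); rewrite !map_mxM.
move=> /(row_free_inj Kf) /matrixP AB; apply/matrixP=> i j.
by have := AB i j; rewrite !mxE => /intr_inj.
Qed.

Lemma unit_int_det k (A : 'M[int]_k) :
  (A \in unitmx) = (\det A \in [:: -1; 1]).
Proof. by rewrite unitmxE !inE unfold_in /= orbC. Qed.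

Lemma kernel_basis_det (r n m g : nat) (N : 'M[int]_(r, m)) (M : 'M[int]_(n, m))
    (K : 'M[int]_(g, m)) :
  row_free (map_mx intr N : 'M[rat]_(r, m)) ->
  row_free (map_mx intr K : 'M[rat]_(g, m)) ->
  K *m N^T = 0 ->
  (forall x : 'rV_m, x *m N^T = 0 -> exists y : 'rV_g, x = y *m K) ->
  (forall t : 'I_r -> 'I_m, \det (colsub t N) \in [:: -1; 0; 1]) ->
  (forall t : 'I_(n + r) -> 'I_m,
    \det (colsub t (col_mx M N)) \in [:: -1; 0; 1]) ->
  m = (n + r)%N -> square_det_unit (K *m M^T).
Proof.
move=> Nf Kf KN Kspan TU TU2 em.
(* A choice of [r] columns independent over the rationals has a nonzero minor, which total
   unimodularity forces to be a unit of the integers. *)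
have [t ut] : exists t, colsub t N \in unitmx.
  have Nfull : row_full (map_mx intr N : 'M[rat]_(r, m))^T.
    by rewrite /row_full mxrank_tr.
  exists (fullrankfun Nfull); have := fullrowsub_unit Nfull.
  have -> : rowsub (fullrankfun Nfull) (map_mx intr N)^T
     = (map_mx intr (colsub (fullrankfun Nfull) N))^T :> 'M[rat]_r.
    by apply/matrixP=> i j; rewrite !mxE.
  rewrite unitmx_tr unitmxE det_map_mx unitfE intr_eq0 unit_int_det => d0.
  by have := TU (fullrankfun Nfull); rewrite !inE (negPf d0).
(* The transpose of an integral right inverse of [N]: the inverse of the selected submatrix, padded
   with zeros. *)
pose B : 'M[int]_(r, m) := (invmx (colsub t N))^T *m (colsub t 1%:M)^T.
have BN : B *m N^T = 1%:M.
  rewrite /B -!trmx_mul mulmxA.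
  have -> : N *m colsub t 1%:M = colsub t N.
    by rewrite mulmx_colsub mulmx1.
  by rewrite mulmxV // trmx1.
(* The rows of [1%:M - N^T *m B] are killed by [N^T], hence are integer combinations of the rows of
   [K]; [X] collects the coefficients. *)
have [X XK] : exists X, 1%:M - N^T *m B = X *m K.
  have rowP i : exists y : 'rV_g, row i (1%:M - N^T *m B) = y *m K.
    apply: Kspan; rewrite -row_mul mulmxBl mul1mx -mulmxA BN mulmx1 subrr.
    by rewrite row0.
  have [x Hx] := fin_all_exists rowP.
  by exists (\matrix_i x i); apply/row_matrixP=> i; rewrite row_mul rowK Hx.
have KX : K *m X = 1%:M.
  apply: (row_free_mulmx_inj Kf); rewrite -mulmxA -XK mulmxBr mulmxA KN.
  by rewrite mul0mx subr0 mulmx1 mul1mx.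
have YQ : row_mx X N^T *m col_mx K B = 1%:M.
  by rewrite mul_row_col -XK subrK.
have QY : col_mx K B *m row_mx X N^T = block_mx 1%:M 0 (B *m X) 1%:M.
  by rewrite mul_col_row KX KN BN.
(* The product in one order is the identity and in the other is unitriangular, which gives
   [m <= g + r] and [g + r <= m]. *)
have eg : g = n.
  have le1 := mulmx1_min YQ.
  have uQY : block_mx 1%:M 0 (B *m X) 1%:M \in unitmx.
    by rewrite unit_int_det det_lblock !det1.
  have : col_mx K B *m (row_mx X N^T *m invmx (block_mx 1%:M 0 (B *m X) 1%:M)) = 1%:M.
    by rewrite mulmxA QY mulmxV.
  by move/mulmx1_min => le2; lia.
subst g m; exists erefl; rewrite castmx_id.
have uQ : \det (col_mx K B) \in [:: -1; 1].
  by rewrite -unit_int_det; case/mulmx1_unit: YQ.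
have <- : \det (col_mx K B *m row_mx M^T N^T) = \det (K *m M^T).
  by rewrite mul_col_row KN BN det_lblock det1 mulr1.
rewrite det_mulmx; apply: sign_mul.
  by move: uQ; rewrite !inE => /orP[]->; rewrite ?orbT.
rewrite -tr_col_mx det_tr.
suff -> : col_mx M N = colsub id (col_mx M N) by exact: TU2.
by apply/matrixP=> i j; rewrite !mxE.
Qed.

(** * Half-edge pairings and closed walks *)

(** The edge partition recast as a fixed-point-free involution, so that every edge traversal is a
    pair [(x, m x)]. *)
Definition is_mate (G : graph) (m : gH G -> gH G) : Prop :=
  [/\ involutive m, forall h, m h != h &
      forall e, e \in gE G <-> exists h, e = [set h; m h]].

Lemma mate_exists (G : graph) : is_graph G -> exists m, @is_mate G m.
Proof.
move=> /andP[part /forall_inP card2].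
have /and3P[/eqP covE triv _] := part.
have edgeP h : exists k, k != h /\ [set h; k] \in gE G.
  have hc : h \in cover (gE G) by rewrite covE inE.
  have eE := pblock_mem hc; have he : h \in pblock (gE G) h by rewrite mem_pblock.
  have /cards2P[x [y [xy exy]]] := card2 _ eE.
  rewrite {}exy in eE he; move: he; rewrite !inE => /orP[]/eqP->.
    by exists y; rewrite eq_sym.
  by exists x; rewrite setUC.
have [m Hm] := fin_all_exists edgeP.
have blk e h : e \in gE G -> h \in e -> e = [set h; m h].
  move=> eE he; rewrite -(def_pblock triv eE he).
  by apply: (def_pblock triv (Hm h).2); rewrite !inE eqxx.
exists m; split.
- move=> h; have /setP/(_ h) := blk _ (m h) (Hm h).2 (set22 _ _).
  rewrite !inE eqxx /= => /esym/orP[]/eqP // hm.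
  by have [/negP[]] := Hm h; rewrite {2}hm.
- by move=> h; case: (Hm h).
move=> e; split=> [eE|[h ->]]; last by case: (Hm h).
have /cards2P[x [y [xy exy]]] := card2 _ eE.
by exists x; apply: blk => //; rewrite exy set21.
Qed.

Section Mate.
Variables (G : graph) (m : gH G -> gH G) (Gm : @is_mate G m).

Lemma mateK : involutive m. Proof. by case: Gm. Qed.
Lemma mate_neq h : m h != h. Proof. by case: Gm. Qed.
Lemma mate_edge h : [set h; m h] \in gE G.
Proof. by case: Gm => _ _ eP; apply/eP; exists h. Qed.

Lemma edge_mate e h : e \in gE G -> h \in e -> e = [set h; m h].
Proof.
case: Gm => _ _ eP /eP[k ->]; rewrite !inE => /orP[]/eqP-> //.
by rewrite mateK setUC.
Qed.

Lemma edge_pair x y : ([set x; y] \in gE G) = (y == m x).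
Proof.
apply/idP/eqP => [eE|->]; last exact: mate_edge.
have /setP/(_ (m x)) := edge_mate eE (set21 x y).
by rewrite !inE eqxx orbT (negPf (mate_neq x)) => /eqP.
Qed.

Definition edge_of h : gedge G := exist _ [set h; m h] (mate_edge h).

Variables (D : gedge G -> gH G) (HD : directed_version D).

Lemma headE e : Defs.head D e = m (D e).
Proof.
rewrite /Defs.head; have De := edge_mate (valP e) (HD e).
case: pickP => [h|/(_ (m (D e)))] /=; last first.
  by rewrite {1}De !inE eqxx orbT mate_neq.
by rewrite {1}De !inE => /andP[/orP[]/eqP->//]; rewrite eqxx.
Qed.

Lemma mem_edge (e : gedge G) h : (h \in val e) = (h == D e) || (h == Defs.head D e).
Proof. by rewrite (edge_mate (valP e) (HD e)) headE !inE. Qed.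

Lemma tail_inj : injective D.
Proof.
move=> e e' De; apply: val_inj.
by rewrite (edge_mate (valP e) (HD e)) (edge_mate (valP e') (HD e')) De.
Qed.

Lemma head_inj : injective (Defs.head D).
Proof. by move=> e e'; rewrite !headE => /(can_inj mateK)/tail_inj. Qed.

Lemma tail_neq_head e e' : D e != Defs.head D e'.
Proof.
apply/eqP => De; have : e = e'.
  apply: val_inj; rewrite (edge_mate (valP e) (HD e)).
  by rewrite (edge_mate (valP e') (HD e')) De headE mateK setUC.
by move=> ee; move/eqP: De; rewrite ee headE eq_sym (negPf (mate_neq _)).
Qed.

Lemma tail_or_head h : exists e, h = D e \/ h = Defs.head D e.
Proof.
exists (edge_of h); apply/pred2P; rewrite /= -mem_edge; exact: set21.
Qed.

(** The sign of a traversal depends only on the half-edge [y] where it leaves the edge. As a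
    difference of indicators it becomes linear and can be summed along walks. *)
Lemma traversal_eq x y (e : gedge G) : y = m x ->
  ([set x; y] == val e)%:R * (if x == D e then 1 else -1) =
  (y == Defs.head D e)%:R - (y == D e)%:R :> int.
Proof.
move=> ->.
have -> : ([set x; m x] == val e) = (x \in val e).
  apply/eqP/idP => [<-|xe]; first exact: set21.
  by rewrite -(edge_mate (valP e) xe).
have -> : (m x == D e) = (x == Defs.head D e).
  by rewrite headE -{1}(mateK (D e)) (inj_eq (can_inj mateK)).
rewrite headE (inj_eq (can_inj mateK)) mem_edge.
have [->|_] /= := eqVneq x (D e).
  by rewrite eq_sym (negPf (mate_neq _)) mul1r subr0.
by rewrite -headE mulrN1 sub0r.
Qed.

Lemma sum_incident_head (j0 : 'I_#|gedge G|) (F : 'I_#|gedge G| -> int) :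
  \sum_j ((Defs.head D (enum_val j0) == Defs.head D (enum_val j))%:R
    - (Defs.head D (enum_val j0) == D (enum_val j))%:R) * F j = F j0.
Proof.
rewrite (bigD1 j0) //= big1 => [|j jj0].
  by rewrite eqxx eq_sym (negPf (tail_neq_head _ _)) /= addr0 subr0 mul1r.
have /negPf-> : Defs.head D (enum_val j0) != Defs.head D (enum_val j).
  by apply: contra jj0 => /eqP/head_inj/enum_val_inj->.
by rewrite eq_sym (negPf (tail_neq_head _ _)) subrr mul0r.
Qed.

Lemma sum_incident_tail (j0 : 'I_#|gedge G|) (F : 'I_#|gedge G| -> int) :
  \sum_j ((D (enum_val j0) == Defs.head D (enum_val j))%:R
    - (D (enum_val j0) == D (enum_val j))%:R) * F j = - F j0.
Proof.
rewrite (bigD1 j0) //= big1 => [|j jj0].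
  by rewrite eqxx (negPf (tail_neq_head _ _)) /= addr0 sub0r mulN1r.
have /negPf-> : D (enum_val j0) != D (enum_val j).
  by apply: contra jj0 => /eqP/tail_inj/enum_val_inj->.
by rewrite (negPf (tail_neq_head _ _)) subrr mul0r.
Qed.

Lemma tail_or_head_index h :
  exists j : 'I_#|gedge G|, h = D (enum_val j) \/ h = Defs.head D (enum_val j).
Proof. by have [e he] := tail_or_head h; exists (enum_rank e); rewrite enum_rankK. Qed.

(** Summation by parts for a potential [g] on half-edges: each traversal contributes the change of
    [g] on its own edge only. *)
Lemma sigma_trav_functional (t : seq (gH G * gH G)) (g : gH G -> int) :
  all (fun p => [set p.1; p.2] \in gE G) t ->
  \sum_j sigma_trav D t 0 j * (g (Defs.head D (enum_val j)) - g (D (enum_val j)))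
  = \sum_(p <- t) (g p.2 - g p.1).
Proof.
move=> /allP tE; under eq_bigr do rewrite mxE mulr_suml.
rewrite exchange_big /=; apply: eq_big_seq => p /tE; rewrite edge_pair => /eqP p2.
under eq_bigr do rewrite traversal_eq //.
have [j [De|De]] := tail_or_head_index p.2; rewrite De.
  rewrite (sum_incident_tail _ (fun j => g (Defs.head D (enum_val j)) - g (D (enum_val j)))).
  rewrite opprB; congr (_ - g _).
  by rewrite headE -De p2 mateK.
rewrite (sum_incident_head _ (fun j => g (Defs.head D (enum_val j)) - g (D (enum_val j)))).
congr (_ - g _); apply: (can_inj mateK).
by rewrite -p2 De headE.
Qed.

(** A traversal joins the second half-edge of one transition to the first half-edge of the next, so
    regrouping the cyclic sum by transitions reverses the differences. *)
Lemma walk_trav_sum (T : eqType) (w : seq (T * T)) (g : T -> int) :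
  \sum_(p <- walk_trav w) (g p.2 - g p.1) = \sum_(p <- w) (g p.1 - g p.2).
Proof.
rewrite !sumrB; congr (_ - _).
  rewrite -(big_map snd xpredT g) /walk_trav -/(unzip2 _) unzip2_zip.
    by rewrite map_rot (perm_big _ (permEl (perm_rot _ _))) big_map.
  by rewrite !size_map size_rot.
rewrite -(big_map fst xpredT g) /walk_trav -/(unzip1 _) unzip1_zip ?big_map //.
by rewrite !size_map size_rot.
Qed.

(** Potentials live on half-edges rather than vertices to serve two ends: the indicator of a vertex
    yields flow conservation, and that of a single transition yields the entries of the touch-graph
    matrix. *)
Lemma sigma_functional (w : seq (gH G * gH G)) (g : gH G -> int) :
  is_closed_walk w ->
  \sum_j sigma D w 0 j * (g (Defs.head D (enum_val j)) - g (D (enum_val j)))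
  = \sum_(p <- w) (g p.1 - g p.2).
Proof. by move=> /andP[_ tE]; rewrite sigma_trav_functional // walk_trav_sum. Qed.

End Mate.

(** * Integral circulations *)

Lemma iter_reaches_cycle (T : finType) (f : T -> T) (x : T) :
  exists i k, uniq (traject f (iter i f x) k.+1) /\
    iter k.+1 f (iter i f x) = iter i f x.
Proof.
(* The orbit of [x] is a tail followed by a cycle; [i] is the index at which the iterate number
   [order f x] rejoins it. *)
have /loopingP/(_ (order f x))/trajectP[i i_lt e] := looping_order f x.
have ek : order f x = (i + (order f x - i.+1).+1)%N by lia.
exists i, (order f x - i.+1)%N; split; last first.
  by rewrite -iterD addnC -ek.
have := orbit_uniq f x; rewrite /orbit {1}ek trajectD cat_uniq.
by move=> /and3P[].
Qed.

Lemma rot1_traject (T : Type) (f : T -> T) y k :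
  iter k.+1 f y = y -> rot 1 (traject f y k.+1) = map f (traject f y k.+1).
Proof.
move=> fy; have map_traject x n : map f (traject f x n) = traject f (f x) n.
  by elim: n x => //= n IH x; rewrite IH.
by rewrite map_traject [in RHS]trajectSr trajectS rot1_cons -iterSr fy.
Qed.

Section Circulation.
Variables (G : graph) (m : gH G -> gH G) (Gm : @is_mate G m).
Variables (D : gedge G -> gH G) (HD : directed_version D).

Definition is_circulation (f : 'rV[int]_#|gedge G|) : Prop :=
  forall v, \sum_j f 0 j * ((gend (Defs.head D (enum_val j)) == v)%:R
                            - (gend (D (enum_val j)) == v)%:R) = 0.

Lemma sigma_circulation w : is_closed_walk w -> is_circulation (sigma D w).
Proof.
move=> Ww v.
rewrite (sigma_functional Gm HD (fun h => (gend h == v)%:R) Ww) big_seq big1 //.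
by move=> p pw; have /andP[/allP/(_ p pw)/andP[_ /eqP->] _] := Ww; rewrite subrr.
Qed.

(** The signed amount of flow arriving at [gend h] through [h]. *)
Definition inflow (f : 'rV[int]_#|gedge G|) (h : gH G) : int :=
  \sum_j f 0 j * ((h == Defs.head D (enum_val j))%:R - (h == D (enum_val j))%:R).

Lemma inflow_head f j : inflow f (Defs.head D (enum_val j)) = f 0 j.
Proof.
rewrite /inflow; under eq_bigr do rewrite mulrC.
exact: (sum_incident_head Gm HD).
Qed.

Lemma inflow_tail f j : inflow f (D (enum_val j)) = - f 0 j.
Proof.
rewrite /inflow; under eq_bigr do rewrite mulrC.
exact: (sum_incident_tail Gm HD).
Qed.

Lemma inflow_mate f h : inflow f (m h) = - inflow f h.
Proof.
have [j [->|->]] := tail_or_head_index Gm HD h.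
  by rewrite -(headE Gm HD) inflow_head inflow_tail opprK.
by rewrite (headE Gm HD) (mateK Gm) -(headE Gm HD) inflow_tail inflow_head.
Qed.

Lemma sum_inflow f v : is_circulation f -> \sum_(h | gend h == v) inflow f h = 0.
Proof.
move=> fc; rewrite -[RHS](fc v) exchange_big /=; apply: eq_bigr => j _.
rewrite -mulr_sumr sumrB.
have ind k : \sum_(h | gend h == v) (h == k)%:R = (gend k == v)%:R :> int.
  rewrite big_mkcond (bigD1 k) //= eqxx big1 ?addr0 => [|h /negPf->].
    by case: eqP.
  by case: ifP.
by rewrite !ind.
Qed.

(** Flow entering a vertex must leave it: from an entering half-edge pass to a leaving one, then to
    its mate, which is entering again. Iterating this on a finite set closes up into a cycle; [c]
    lists its entering half-edges. *)
Lemma positive_cycle f : is_circulation f -> f != 0 ->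
  exists c : seq (gH G), exists out,
  let w := [seq (h, out h) | h <- c] in
  [/\ c != [::], uniq c, {in c, forall h, 0 < inflow f h}, is_closed_walk w &
      forall j, sigma D w 0 j =
        (Defs.head D (enum_val j) \in c)%:R - (D (enum_val j) \in c)%:R].
Proof.
move=> fcirc f0.
have [h0 h0pos] : exists h, 0 < inflow f h.
  have [j fj] : exists j, f 0 j != 0.
    by apply/existsP; apply: contraNT f0 => /existsPn f0; apply/eqP/rowP=> j;
       rewrite mxE; apply/eqP/negPn.
  case: (ltgtP (f 0 j) 0) fj => // [fj|fj] _.
    by exists (D (enum_val j)); rewrite inflow_tail oppr_gt0.
  by exists (Defs.head D (enum_val j)); rewrite inflow_head.
(* If no half-edge at the vertex had negative inflow, all inflows there would vanish. The premise
   sits under the existential so that [out] is total; it is unconstrained where the inflow is not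
   positive. *)
have outP h : exists k, 0 < inflow f h -> gend k = gend h /\ inflow f k < 0.
  case: (boolP [exists k, (gend k == gend h) && (inflow f k < 0)]).
    by move=> /existsP[k /andP[/eqP ? ?]]; exists k.
  move=> /existsPn nk; exists h => hpos; have := sum_inflow (gend h) fcirc.
  have ge0 k : gend k == gend h -> 0 <= inflow f k.
    by have := nk k; rewrite negb_and leNgt => /orP[/negPf->|].
  by move=> /(psumr_eq0P ge0)/(_ h (eqxx _)) hz; rewrite hz ltxx in hpos.
have [out Hout] := fin_all_exists outP.
pose g h := m (out h).
have gpos h : 0 < inflow f h -> 0 < inflow f (g h).
  by move=> /Hout[_]; rewrite inflow_mate oppr_gt0.
have ipos n x : 0 < inflow f x -> 0 < inflow f (iter n g x).
  by move=> px; elim: n => //= n; apply: gpos.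
have [i [k [Uc yk]]] := iter_reaches_cycle g h0.
set y := iter i g h0 in Uc yk; set c := traject g y k.+1 in Uc.
have cpos : {in c, forall h, 0 < inflow f h}.
  by move=> h /trajectP[n _ ->]; do 2!apply: (ipos).
have tr : walk_trav [seq (h, out h) | h <- c] = [seq (out h, g h) | h <- c].
  rewrite /walk_trav -map_rot (rot1_traject yk : rot 1 c = map g c) -!map_comp.
  by rewrite zip_map.
exists c, out; split=> //.
- apply/andP; split; apply/allP => p.
    move=> /mapP[h hc ->]; have hpos := cpos h hc; have [e n] := Hout _ hpos.
    rewrite /dst /= e eqxx andbT; apply/eqP => he; move: n; rewrite -he.
    by rewrite ltNge ltW.
  by rewrite tr => /mapP[h hc ->]; apply: (mate_edge Gm).
move=> j; rewrite /sigma tr mxE big_map.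
under eq_bigr => h _ do rewrite (traversal_eq Gm HD _ (erefl : g h = m (out h))).
(* As [g] shifts [c] cyclically, the sum over the half-edges [g h] is again a sum over [c]. *)
rewrite -(big_map g xpredT
   (fun h => (h == Defs.head D (enum_val j))%:R - (h == D (enum_val j))%:R)).
rewrite -(rot1_traject yk) (perm_big _ (permEl (perm_rot _ _))) /= sumrB.
have cnt h : \sum_(x <- c) (x == h)%:R = (h \in c)%:R :> int.
  rewrite -(count_uniq_mem _ Uc) -sum1_count natr_sum [RHS]big_mkcond /=.
  by apply: eq_bigr => x _; case: eqP.
by rewrite -!cnt.
Qed.

(* A nonzero circulation carries a closed walk traversing edges along the flow;
   subtracting it decreases the l1-norm. *)
Lemma circulation_ind (S : 'rV[int]_#|gedge G| -> Prop) :
  S 0 -> (forall w, is_closed_walk w -> S (sigma D w)) ->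
  (forall x y, S x -> S y -> S (x + y)) ->
  forall f, is_circulation f -> S f.
Proof.
move=> S0 Sw SD f; have [n] := ubnP (\sum_j `|f 0%R j|%N); elim: n f => // n IH f.
rewrite ltnS => fn fcirc; have [->//|f0] := eqVneq f 0.
have [c [out [c0 Uc cpos Ww sE]]] := positive_cycle fcirc f0.
set w := [seq _ | _ <- _] in Ww sE.
rewrite -(subrK (sigma D w) f); apply: (SD) (Sw _ Ww); apply: IH; last first.
  move=> v; under eq_bigr => j _ do rewrite mxE [X in _ + X]mxE mulrBl.
  by rewrite sumrB fcirc (sigma_circulation Ww) subrr.
apply: leq_trans fn.
(* The walk agrees in sign with [f] on every edge it uses, so subtracting it lowers the absolute
   value at [j] by exactly [r j]. *)
pose r (j : 'I_#|gedge G|) : nat :=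
  ((Defs.head D (enum_val j) \in c) + (D (enum_val j) \in c))%N.
have fE j : `|f 0%R j|%N = (`|(f - sigma D w)%R 0%R j| + r j)%N.
  rewrite mxE [X in _ + X]mxE sE /r.
  have hpos : Defs.head D (enum_val j) \in c -> 0 < f 0 j.
    by move=> /cpos; rewrite inflow_head.
  have tpos : D (enum_val j) \in c -> 0 < - f 0 j.
    by move=> /cpos; rewrite inflow_tail.
  move: hpos tpos; case: (_ \in c) => hp; case: (_ \in c) => tp /=;
    try have := hp isT; try have := tp isT; move: (f 0 j) => z; clear; lia.
rewrite (eq_bigr _ (fun j _ => fE j)) big_split /= -[X in (X < _)%N]addn0 ltn_add2l.
case: c c0 @r {Uc cpos Ww sE fE w} => // h c _ r.
(* The edge of any half-edge in [c] makes the decrease strict. *)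
have [j hj] := tail_or_head_index Gm HD h.
rewrite (bigD1 j) //= addn_gt0 /r.
by case: hj => <-; rewrite !inE eqxx /= ?addn1 ?orbT.
Qed.

End Circulation.

(** * Edge deletion and touch-graphs *)

Section Deletion.
Variables (F : graph) (m : gH F -> gH F) (Fm : @is_mate F m).
Variables (E : {set {set gH F}}) (sE : E \subset gE F).

Lemma mate_cover h : (m h \in cover E) = (h \in cover E).
Proof.
have half k : k \in cover E -> m k \in cover E.
  move=> /bigcupP[e eE ke]; apply/bigcupP; exists e => //.
  by rewrite (edge_mate Fm (subsetP sE e eE) ke) set22.
by apply/idP/idP => /half //; rewrite (mateK Fm).
Qed.

Lemma mem_cover_edge h e : e \in gE F -> h \in e -> (h \in cover E) = (e \in E).
Proof.
move=> eF he; apply/bigcupP/idP => [[e' e'E he']|eE]; last by exists e.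
by rewrite (edge_mate Fm eF he) -(edge_mate Fm (subsetP sE _ e'E) he').
Qed.

Lemma minus_mate : exists m' : gH (FminusE E) -> gH (FminusE E),
  is_mate m' /\ forall x, val (m' x) = m (val x).
Proof.
have mN (x : minusH E) : m (val x) \notin cover E by rewrite mate_cover (valP x).
exists (fun x => Sub (m (val x)) (mN x)); split=> //; split.
- by move=> x; apply: val_inj; rewrite /= (mateK Fm).
- by move=> x; rewrite -val_eqE /= (mate_neq Fm).
have preim x : [set z : minusH E | val z \in [set val x; m (val x)]]
    = [set x; Sub (m (val x)) (mN x)].
  by apply/setP=> z; rewrite !inE -!val_eqE.
move=> e; split=> [/imsetP[e0]|[x ->]].
  rewrite inE => /andP[eNE eF] ->.
  have [h e0E] : exists h, e0 = [set h; m h] by case: Fm => _ _ /(_ e0)[+ _]; exact.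
  have hN : h \notin cover E by rewrite (@mem_cover_edge h e0) // e0E set21.
  by exists (Sub h hN); rewrite -preim e0E.
apply/imsetP; exists [set val x; m (val x)]; last by rewrite preim.
rewrite inE (mate_edge Fm) andbT -(@mem_cover_edge (val x)) ?(mate_edge Fm) ?set21 //.
exact: (valP x).
Qed.

(** An edge outside [E] keeps its half-edges in [FminusE E], so it can be recovered from its
    image. *)
Lemma card_minus_edges : (#|gE (FminusE E)| + #|E| = #|gE F|)%N.
Proof.
rewrite card_in_imset => [|e1 e2].
  by rewrite cardsD (setIidPr sE) subnK // subset_leq_card.
rewrite !inE => /andP[e1N e1F] /andP[_ e2F] /setP e12.
have [h e1E] : exists h, e1 = [set h; m h] by case: Fm => _ _ /(_ e1)[+ _]; exact.
have hN : h \notin cover E by rewrite (@mem_cover_edge h e1) // e1E set21.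
have := e12 (Sub h hN); rewrite !inE /= {1}e1E set21 => /esym he2.
by rewrite (edge_mate Fm e2F he2).
Qed.

End Deletion.

Lemma card_gedge (G : graph) : #|gedge G| = #|gE G|.
Proof. by rewrite card_sig; apply: eq_card => e; rewrite inE. Qed.

Lemma card_half_edges (G : graph) : is_graph G -> #|gH G| = (#|gE G| * 2)%N.
Proof.
move=> /andP[part /forall_inP card2]; rewrite -cardsT.
by apply: card_uniform_partition part => e /card2/eqP.
Qed.

Lemma card_four_regular (F : graph) : four_regular F -> #|gE F| = (#|gV F| * 2)%N.
Proof.
move=> [gF reg]; have := card_half_edges gF.
have -> : #|gH F| = (#|gV F| * 4)%N; last by lia.
rewrite -[LHS]sum1_card (partition_big (@gend F) xpredT) //= -sum_nat_const.
by apply: eq_bigr => v _; rewrite -[RHS](reg v) -sum1_card; apply: eq_bigl => h; rewrite inE.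
Qed.

Lemma count_eq1_inj (T : eqType) (a : pred T) (s : seq T) x y :
  count a s = 1%N -> x \in s -> y \in s -> a x -> a y -> x = y.
Proof.
rewrite -size_filter => s1 xs ys ax ay.
have : x \in filter a s by rewrite mem_filter ax.
have : y \in filter a s by rewrite mem_filter ay.
by case: (filter a s) s1 => [|z []] //= _; rewrite !inE => /eqP-> /eqP->.
Qed.

Section TouchGraph.
Variables (F : graph) (P : seq (seq (gH F * gH F))).
Hypotheses (reg : four_regular F) (cP : circuit_partition P).

Lemma mem_stP t : (t \in stP P) = has (fun p => t == [set p.1; p.2]) (flatten P).
Proof.
rewrite /stP; elim: P => [|C Q IH]; first by rewrite big_nil inE.
rewrite big_cons inE IH /= has_cat; congr (_ || _).
apply/imsetP/hasP => [[p pC ->]|[p pC /eqP->]]; by exists p.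
Qed.

Lemma flatten_dst p : p \in flatten P -> dst p.1 p.2.
Proof.
case: cP => /allP circ _ /flattenP[C /circ /and3P[/andP[/allP + _] _ _]].
by move=> tr /tr.
Qed.

Lemma count_half_edge (h : gH F) :
  count (fun p => (p.1 == h) || (p.2 == h)) (flatten P) = 1%N.
Proof. by case: cP => _ /(_ h) <-; rewrite count_flatten sumnE big_map. Qed.

Lemma single_transition_ex (h : gH F) : exists s : TchH P, h \in val s.
Proof.
have [p pP hp] : exists2 p, p \in flatten P & (p.1 == h) || (p.2 == h).
  by apply/hasP; rewrite has_count count_half_edge.
have sP : [set p.1; p.2] \in stP P by rewrite mem_stP; apply/hasP; exists p.
by exists (Sub [set p.1; p.2] sP); rewrite /= !inE ![h == _]eq_sym.
Qed.

Lemma single_transition_uniq (h : gH F) (s t : TchH P) :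
  h \in val s -> h \in val t -> s = t.
Proof.
have /hasP[p pP /eqP sp] : has (fun p => val s == [set p.1; p.2]) (flatten P).
  by rewrite -mem_stP (valP s).
have /hasP[q qP /eqP tq] : has (fun p => val t == [set p.1; p.2]) (flatten P).
  by rewrite -mem_stP (valP t).
move=> hs ht; apply: val_inj; rewrite sp tq.
rewrite (count_eq1_inj (count_half_edge h) pP qP) //.
  by move: hs; rewrite sp !inE ![h == _]eq_sym.
by move: ht; rewrite tq !inE ![h == _]eq_sym.
Qed.

Lemma single_transition_card (s : TchH P) :
  #|val s| = 2%N /\ forall h k, h \in val s -> k \in val s -> gend h = gend k.
Proof.
have /hasP[p /flatten_dst/andP[p12 /eqP pv] /eqP->] :
    has (fun p => val s == [set p.1; p.2]) (flatten P).
  by rewrite -mem_stP (valP s).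
split; first by rewrite cards2 p12.
by move=> h k; rewrite !inE => /orP[]/eqP-> /orP[]/eqP->.
Qed.

(** Each half-edge lies in one single transition of [P], and single transitions have two half-edges
    at a common vertex. The four half-edges at a vertex thus form two single transitions, whose pair
    is one edge of the touch-graph. *)
Lemma touch_graph_structure : exists (s : gH F -> TchH P) (vtx : TchH P -> gV F),
  [/\ forall h (t : TchH P), (h \in val t) = (s h == t), forall h, vtx (s h) = gend h,
      forall v, #|[set t | vtx t == v]| = 2%N &
      TchE P = [set [set t | vtx t == v] | v : gV F]].
Proof.
have [s hs] := fin_all_exists single_transition_ex.
have memE h (t : TchH P) : (h \in val t) = (s h == t).
  apply/idP/eqP => [ht|<-//]; exact: single_transition_uniq (hs h) ht.
have repP (t : TchH P) : exists h, h \in val t.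
  by apply/set0Pn; rewrite -card_gt0 (single_transition_card t).1.
have [rep hrep] := fin_all_exists repP.
pose vtx t := gend (rep t).
have vtxE h (t : TchH P) : h \in val t -> vtx t = gend h.
  by move=> ht; apply: (single_transition_card t).2.
have vtx_s h : vtx (s h) = gend h by apply: vtxE.
have star v : [set h | gend h == v] = \bigcup_(t in [set t | vtx t == v]) val t.
  apply/setP=> h; rewrite inE; apply/idP/bigcupP => [hv|[t]].
    by exists (s h); rewrite // inE vtx_s.
  by rewrite inE => + /vtxE <-.
have disj (t u : TchH P) : t != u -> val t :&: val u = set0.
  move=> tu; apply/eqP/set0Pn => -[h]; rewrite inE !memE => /andP[/eqP ht /eqP hu].
  by rewrite -ht hu eqxx in tu.
have card_star v : #|[set h : gH F | gend h == v]| = 4%N by case: reg.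
have fiber2 v : #|[set t | vtx t == v]| = 2%N.
  have : (\sum_(t in [set t | vtx t == v]) 2 = 4)%N.
    rewrite -(card_star v) -sum1_card.
    rewrite (partition_big s (mem [set t | vtx t == v])) /=; last first.
      by move=> h; rewrite !inE vtx_s.
    apply: eq_bigr => t; rewrite inE => /eqP tv.
    rewrite -(single_transition_card t).1 -sum1_card; apply: eq_bigl => h.
    rewrite inE memE; case: (s h =P t) => [st|]; last by rewrite andbF.
    by rewrite andbT -vtx_s st tv eqxx.
  by rewrite sum_nat_const; lia.
have single (t : TchH P) : single_tr (val t).
  have [/eqP/cards2P[x [y [xy te]]] same] := single_transition_card t.
  apply/existsP; exists x; apply/existsP; exists y.
  by rewrite xy te eqxx andbT /=; apply/eqP/same; rewrite te ?set21 ?set22.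
exists s, vtx; split=> //.
apply/setP=> e; rewrite inE; apply/existsP/imsetP => [[t /existsP[u]]|[v _ ->]].
  (* The two members of a transition at [v] cover all half-edges at [v], which leaves room for no
     third single transition there. *)
  move=> /andP[/eqP-> /existsP[v /and4P[_ _ /eqP tu0 /eqP tuv]]].
  exists v => //; apply/setP=> z.
  have tv : vtx t = v.
    apply/eqP; have : rep t \in [set h | gend h == v] by rewrite -tuv inE hrep.
    by rewrite inE.
  have uv : vtx u = v.
    apply/eqP; have : rep u \in [set h | gend h == v] by rewrite -tuv inE hrep orbT.
    by rewrite inE.
  rewrite !inE; apply/orP/eqP => [[]/eqP->//|zv].
  have : rep z \in val t :|: val u by rewrite tuv inE -zv.
  by rewrite inE !memE; have := hrep z; rewrite memE => /eqP->; move/orP.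
have /eqP/cards2P[t [u [tu fE]]] := fiber2 v.
have tv : vtx t = v.
  by apply/eqP; have := set21 t u; rewrite -fE inE.
have uv : vtx u = v.
  by apply/eqP; have := set22 t u; rewrite -fE inE.
exists t; apply/existsP; exists u; rewrite fE eqxx /=.
apply/existsP; exists v; rewrite /transition_at !single disj ?eqxx //=.
by rewrite star fE bigcup_setU !big_set1.
Qed.

End TouchGraph.

(** * Based edge sets *)

Lemma even_involution (T : finType) (f : T -> T) (X : {set T}) :
  involutive f -> (forall x, f x != x) -> {in X, forall x, f x \in X} ->
  ~~ odd #|X|.
Proof.
move=> fK fN; have [n] := ubnP #|X|; elim: n X => // n IH X; rewrite ltnS => Xn fX.
have [->|[x xX]] := set_0Vmem X; first by rewrite cards0.
have fxX := fX x xX.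
have fxX' : f x \in X :\ x by rewrite !inE fN.
have cX : #|X| = #|X :\ x :\ f x|.+2.
  by rewrite (cardsD1 x) xX (cardsD1 (f x) (X :\ x)) fxX'.
rewrite cX /= negbK; apply: IH; first by rewrite cX in Xn; lia.
move=> y; rewrite !inE => /and3P[yfx yx yX]; rewrite fX // andbT.
rewrite (inj_eq (can_inj fK)) yx /=; apply: contra yfx => /eqP<-.
by rewrite fK.
Qed.

Section Based.
Variables (F : graph) (m : gH F -> gH F) (Fm : @is_mate F m).
Variables (E : {set {set gH F}}) (bE : based E).
Hypothesis reg : four_regular F.

Let sE : E \subset gE F. Proof. by case: bE. Qed.

Lemma based_uniq v e e' h h' : e \in E -> e' \in E -> h \in e -> h' \in e' ->
  connect (@adj F) v (gend h) -> connect (@adj F) v (gend h') -> e = e'.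
Proof.
case: bE => _ /(_ v)/eqP/cards1P[e0 Ee0] eE e'E he he' c c'.
have : e \in [set e0].
  by rewrite -Ee0 inE eE; apply/existsP; exists h; rewrite he.
have : e' \in [set e0].
  by rewrite -Ee0 inE e'E; apply/existsP; exists h'; rewrite he'.
by rewrite !inE => /eqP-> /eqP->.
Qed.

Lemma adj_mate h : adj (gend h) (gend (m h)).
Proof.
apply/existsP; exists [set h; m h]; rewrite (mate_edge Fm) /=.
apply/existsP; exists h; rewrite set21; apply/existsP; exists (m h).
by rewrite set22 !eqxx eq_sym (mate_neq Fm).
Qed.

Lemma adjP u v : adj u v -> exists h, u = gend h /\ v = gend (m h).
Proof.
move=> /existsP[e /andP[eF /existsP[h /andP[he /existsP[k /and4P[ke hk /eqP<- /eqP<-]]]]]].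
exists h; split=> //; congr gend; move: ke; rewrite (edge_mate Fm eF he) !inE.
by rewrite eq_sym (negPf hk) => /eqP.
Qed.

(* F has no bridge: otherwise the shore of a bridge would be incident with an odd
   number of half-edges, all vertices having even degree. *)
Lemma constant_across_based (T : eqType) (y : gV F -> T) :
  (forall h, h \notin cover E -> y (gend (m h)) = y (gend h)) ->
  forall h, y (gend (m h)) = y (gend h).
Proof.
move=> yN h; apply/eqP; have [hE|/yN->//] := boolP (h \in cover E).
apply/negPn/negP => yh.
(* [S] is the shore of the supposed bridge and [A] the set of half-edges ending in it. *)
pose S := [set v | connect (@adj F) (gend h) v && (y v == y (gend h))].
pose A := [set k : gH F | gend k \in S].
have hA : h \in A by rewrite !inE connect0 eqxx.
have evenA : ~~ odd #|A|.
  have -> : #|A| = (#|S| * 4)%N; last by rewrite oddM andbF.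
  rewrite -sum1_card (partition_big (@gend F) (mem S)) => [|k]; last by rewrite inE.
  rewrite -sum_nat_const; apply: eq_bigr => v vS.
  case: reg => _ /(_ v) <-; rewrite -sum1_card; apply: eq_bigl => k.
  move: vS; rewrite !inE; case: (gend k =P v) => [->|]; last by rewrite andbF.
  by rewrite andbT => ->.
(* Only [h] has its mate outside [A]: crossing an edge outside [E] preserves [y], and the edge of
   [h] is the sole edge of [E] in its component. *)
have : ~~ odd #|A :\ h|.
  apply: (even_involution (mateK Fm) (mate_neq Fm)) => k.
  rewrite !inE => /and3P[kh ck /eqP yk].
  have cmk : connect (@adj F) (gend h) (gend (m k)).
    exact: connect_trans ck (connect1 (adj_mate k)).
  rewrite cmk /=; have [kE|kN] := boolP (k \in cover E); last first.
    rewrite yN // yk eqxx andbT; apply: contraNneq kN => mkh.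
    by rewrite -(mate_cover Fm sE) mkh.
  have [/bigcupP[e eE ke] /bigcupP[e' e'E he']] := (kE, hE).
  have ee' := based_uniq eE e'E ke he' ck (connect0 _ _).
  move: ke; rewrite ee' (edge_mate Fm (subsetP sE _ e'E) he') !inE (negPf kh) /=.
  by move=> /eqP kmh; rewrite -yk kmh eqxx in yh.
by move: evenA; rewrite (cardsD1 h A) hA /= negbK => ->.
Qed.

(** The root of a component is an end of its edge in [E]. The second clause serves the rank of the
    incidence matrix with root rows removed, the third the recovery of conservation at the roots. *)
Lemma roots_exist : exists R : {set gV F},
  [/\ #|R| = #|E|,
      forall (V : zmodType) (y : gV F -> V),
        (forall h, y (gend (m h)) = y (gend h)) ->
        (forall v, v \in R -> y v = 0) -> forall v, y v = 0 &
      forall u v, u \in R -> v \in R -> connect (@adj F) u v -> u = v].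
Proof.
pose sE' : finType := {e : {set gH F} | e \in E}.
have rootP (e : sE') : exists h, h \in val e.
  have [h eh] : exists h, val e = [set h; m h].
    by case: Fm => _ _ /(_ (val e))[+ _]; apply; apply: (subsetP sE _ (valP e)).
  by exists h; rewrite eh set21.
have [r Hr] := fin_all_exists rootP.
have r_uniq v (e e' : sE') h : h \in val e' -> connect (@adj F) v (gend (r e)) ->
    connect (@adj F) v (gend h) -> e = e'.
  move=> he' c c'; apply: val_inj.
  exact: based_uniq (valP e) (valP e') (Hr e) he' c c'.
exists [set gend (r e) | e in [set: sE']]; split.
- rewrite card_imset ?cardsT ?card_sig; first by apply: eq_card => e; rewrite !inE.
  by move=> e e' ee'; apply: (r_uniq (gend (r e)) _ _ (r e')); rewrite ?ee' ?connect0.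
- move=> V y ym yR v; have yc u w : connect (@adj F) u w -> y u = y w.
    move=> /connectP[p + ->]; elim: p u => //= a p IH u /andP[/adjP[h [-> ea]] pa].
    by rewrite -(IH a pa) ea ym.
  have [e0] : exists e, e \in [set e in E | [exists h in e, connect (@adj F) v (gend h)]].
    by apply/card_gt0P; case: bE => _ ->.
  rewrite inE => /andP[eE /existsP[h /andP[he cvh]]].
  have := Hr (Sub e0 eE); set k := r _ => ke.
  have yhk : y (gend h) = y (gend k).
    by move: ke; rewrite /= (edge_mate Fm (subsetP sE _ eE) he) !inE => /orP[]/eqP->.
  by rewrite (yc _ _ cvh) yhk yR //; apply: imset_f.
move=> u v /imsetP[e _ ->] /imsetP[e' _ ->] c; congr (gend (r _)).
exact: r_uniq (Hr e') (connect0 _ _) c.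
Qed.

End Based.

(** * The touch-graph matrix *)

(** The mate swaps the two single transitions of [P] at a vertex, which identifies the edges of the
    touch-graph with the vertices of [F]. *)
Lemma touch_graph_mate (F : graph) (P : seq (seq (gH F * gH F))) :
  four_regular F -> circuit_partition P ->
  exists (s : gH F -> TchH P) (vtx : TchH P -> gV F) (m : gH (Tch P) -> gH (Tch P)),
  [/\ forall h (t : TchH P), (h \in val t) = (s h == t),
      forall h, vtx (s h) = gend h,
      is_mate m,
      forall t u, (vtx t == vtx u) = (t == u) || (t == m u) &
      (forall v, exists t, vtx t = v) /\ #|gedge (Tch P)| = #|gV F| ].
Proof.
move=> reg cP; have [s [vtx [memE vtx_s fiber2 TchEE]]] := touch_graph_structure reg cP.
have surj v : exists t, vtx t = v.
  have /set0Pn[t] : [set t | vtx t == v] != set0 by rewrite -card_gt0 fiber2.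
  by rewrite inE => /eqP; exists t.
have otherP t : exists u, u != t /\ [set w | vtx w == vtx t] = [set t; u].
  have /eqP/cards2P[a [b [ab fE]]] := fiber2 (vtx t).
  have : t \in [set a; b] by rewrite -fE inE.
  rewrite !inE => /orP[]/eqP ta; subst t; first by exists b; rewrite eq_sym.
  by exists a; rewrite fE setUC.
have [m Hm] := fin_all_exists otherP.
have vtx_eq t u : (vtx t == vtx u) = (t == u) || (t == m u).
  by have /setP/(_ t) := (Hm u).2; rewrite !inE.
have vtx_m t : vtx (m t) = vtx t by apply/eqP; rewrite vtx_eq eqxx orbT.
exists s, vtx, m; split=> //.
  split; first 2 last.
  - move=> e; rewrite /= TchEE; split=> [/imsetP[v _ ->]|[t ->]].
      by have [t <-] := surj v; exists t; case: (Hm t).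
    by apply/imsetP; exists (vtx t) => //; case: (Hm t).
  - move=> t; have : vtx t == vtx (m t) by rewrite vtx_m.
    by rewrite vtx_eq eq_sym (negPf (Hm t).1) => /eqP.
  by move=> t; case: (Hm t).
split=> //; rewrite card_gedge /= TchEE card_imset // => u v.
have [t <-] := surj u; move=> /setP/(_ t); rewrite !inE eqxx.
by move=> /esym/eqP.
Qed.

(** Needed because the rows of [CM] are indexed by the size of a mapped list. *)
Lemma square_det_unit_cast (a b n : nat) (e : a = b) (A : 'M[int]_(a, n))
    (B : 'M[int]_(b, n)) :
  (forall i j, A i j = B (cast_ord e i) j) -> square_det_unit B -> square_det_unit A.
Proof.
case: _ / e B => B AB; have -> // : A = B.
by apply/matrixP=> i j; rewrite AB cast_ord_id.
Qed.

Section TouchMatrix.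
Variables (F : graph) (P : seq (seq (gH F * gH F))) (E : {set {set gH F}}).
Variables (D : gedge (Tch P) -> gH (Tch P)).
Variables (D0 : gedge (FminusE E) -> gH (FminusE E)).
Hypotheses (HD : directed_version D) (HD0 : directed_version D0).

Section Projection.
Variables (s : gH F -> TchH P) (vtx : TchH P -> gV F).
Variables (mT : gH (Tch P) -> gH (Tch P)) (m' : gH (FminusE E) -> gH (FminusE E)).
Hypotheses (memE : forall h (t : TchH P), (h \in val t) = (s h == t)).
Hypotheses (vtx_s : forall h, vtx (s h) = gend h).
Hypotheses (mateT : is_mate mT) (mate' : is_mate m').
Hypotheses (vtx_eq : forall t u, (vtx t == vtx u) = (t == u) || (t == mT u)).

(** [sigma_functional] for the indicator of the tail of edge [j]. The pairs deleted by [pi_P] have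
    equal indicators at both ends and contribute zero. *)
Lemma sigma_pi_P (W : seq (gH (FminusE E) * gH (FminusE E))) j :
  is_closed_walk W ->
  sigma_trav D (pi_P P (lift_walk W)) 0 j =
  \sum_k sigma D0 W 0 k *
    ((s (val (Defs.head D0 (enum_val k))) == D (enum_val j))%:R
     - (s (val (D0 (enum_val k))) == D (enum_val j))%:R).
Proof.
move=> Ww; rewrite (sigma_functional mate' HD0
  (fun x => (s (val x) == D (enum_val j))%:R) Ww).
have pickE h : [pick t : TchH P | h \in val t] = Some (s h).
  case: pickP => [t|/(_ (s h))]; rewrite memE; first by move=> /eqP->.
  by rewrite eqxx.
rewrite mxE /pi_P big_pmap big_map; apply: eq_big_seq => p pW /=.
have /andP[/allP/(_ p pW)/andP[_ /eqP gp] _] := Ww.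
rewrite !pickE; case: eqVneq => [->|tu] /=; first by rewrite subrr.
have : vtx (s (val p.2)) == vtx (s (val p.1)) by rewrite !vtx_s; apply/eqP.
rewrite vtx_eq eq_sym (negPf tu) /= => /eqP um.
(* A traversal leaves the edge at its head exactly when it enters at its tail. *)
rewrite (traversal_eq mateT HD _ um); congr (_%:R - _).
by rewrite (headE mateT HD) um (inj_eq (can_inj (mateK mateT))).
Qed.

End Projection.

(** Subtracting the tail row at a vertex from its vertex row leaves the head row. The rows are then
    labelled by distinct single transitions, and [det_network] applies. *)
Lemma resolution_matrix_tu (s : gH F -> TchH P) (vtx : TchH P -> gV F)
    (m : gH (Tch P) -> gH (Tch P)) (U : {set gV F}) (k : nat) (a b : 'I_k -> gH F)
    (t : 'I_(#|gedge (Tch P)| + #|U|) -> 'I_k) :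
  (forall h, vtx (s h) = gend h) -> is_mate m ->
  (forall t u, (vtx t == vtx u) = (t == u) || (t == m u)) ->
  (forall v, exists t, vtx t = v) ->
  \det (colsub t (col_mx
    (\matrix_(i < #|gedge (Tch P)|, j < k)
       ((s (a j) == D (enum_val i))%:R - (s (b j) == D (enum_val i))%:R))
    (\matrix_(i < #|U|, j < k)
       ((gend (a j) == enum_val i)%:R - (gend (b j) == enum_val i)%:R)))
    : 'M[int]_(#|gedge (Tch P)| + #|U|)) \in [:: -1; 0; 1].
Proof.
move=> vtx_s mateT vtx_eq surj.
(* The tail and head of [e v] are the two single transitions at [v]. *)
have tailP v : exists e, vtx (D e) = v.
  have [u <-] := surj v; exists (edge_of mateT u); apply/eqP.
  by rewrite vtx_eq; have := HD (edge_of mateT u); rewrite !inE.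
have [e eP] := fin_all_exists tailP.
have e_inj : injective e by move=> u v uv; rewrite -(eP u) uv eP.
pose split_row (x : 'I_(#|gedge (Tch P)| + #|U|)) := match split x with
  | inl i => D (enum_val i)
  | inr u => Defs.head D (e (enum_val (u : 'I_#|U|)))
  end.
have split_inj : injective split_row.
  move=> x y; rewrite /split_row -{2}(splitK x) -{2}(splitK y).
  case: (split x) => i; case: (split y) => i' /= E0; first 1 last.
  - by move/eqP: E0; rewrite (negPf (tail_neq_head mateT HD _ _)).
  - by move/esym/eqP: E0; rewrite (negPf (tail_neq_head mateT HD _ _)).
  - by move/(head_inj mateT HD)/e_inj/enum_val_inj: E0 => ->.
  by move/(tail_inj mateT HD)/enum_val_inj: E0 => ->.
set M := \matrix_(i, j) _; set N := \matrix_(i, j) _.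
(* A vertex row is the sum of the rows of the two single transitions there. *)
pose B : 'M[int]_(#|U|, k) := \matrix_(u, j)
  ((s (a j) == Defs.head D (e (enum_val u)))%:R
   - (s (b j) == Defs.head D (e (enum_val u)))%:R).
pose L : 'M[int]_(#|U|, #|gedge (Tch P)|) :=
  \matrix_(u, i) (i == enum_rank (e (enum_val u)))%:R.
have vertex_split h v : (gend h == v)%:R
    = (s h == D (e v))%:R + (s h == Defs.head D (e v))%:R :> int.
  rewrite -{1}(eP v) -vtx_s vtx_eq -(headE mateT HD).
  case: eqVneq => [->|_] /=; last by rewrite add0r.
  by rewrite (negPf (tail_neq_head mateT HD _ _)) addr0.
have -> : col_mx M N = block_mx 1%:M 0 L 1%:M *m col_mx M B.
  rewrite mul_block_col !mul1mx mul0mx addr0; congr col_mx.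
  apply/matrixP=> u j; rewrite !mxE (bigD1 (enum_rank (e (enum_val u)))) //=.
  rewrite big1 ?addr0 => [|i /negPf iu]; last by rewrite !mxE iu mul0r.
  by rewrite !mxE eqxx mul1r enum_rankK !vertex_split opprD addrACA.
rewrite -mulmx_colsub det_mulmx det_lblock !det1 !mul1r.
have := det_network (s \o a \o t) (s \o b \o t) split_inj.
rewrite (_ : \matrix_(_, _) _ = colsub t (col_mx M B)) //.
apply/matrixP=> x j; rewrite !mxE /split_row.
by case: (split x) => i; rewrite !mxE ?[D _ == _]eq_sym ?[Defs.head D _ == _]eq_sym.
Qed.

End TouchMatrix.

Theorem mainTheorem15 (F : graph) (P : seq (seq (gH F * gH F)))
  (E : {set {set gH F}})
  (D : gedge (Tch P) -> gH (Tch P))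
  (D0 : gedge (FminusE E) -> gH (FminusE E))
  (Gam : seq (seq (gH (FminusE E) * gH (FminusE E)))) :
  four_regular F ->
  circuit_partition P ->
  based E ->
  directed_version D ->
  directed_version D0 ->
  integral_cycle_basis D0 Gam ->
  square_det_unit (CM D [seq pi_P P (lift_walk W) | W <- Gam]).
Proof.
move=> reg cP bE HD HD0 [[GamW [_ [Gfree _]]] Gspan].
have sE : E \subset gE F by case: bE.
have [m Fm] := mate_exists reg.1.
have [m' [Fm' valm']] := minus_mate Fm sE.
have [s [vtx [mT [memE vtx_s mateT vtx_eq [surj cardT]]]]] := touch_graph_mate reg cP.
have [R [cardR detR rootR]] := roots_exist Fm bE.
set n := #|gedge (Tch P)|; set k := #|gedge (FminusE E)|.
pose a (j : 'I_k) := val (Defs.head D0 (enum_val j)).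
pose b (j : 'I_k) := val (D0 (enum_val j)).
pose M : 'M[int]_(n, k) := \matrix_(i < n, j < k)
  ((s (a j) == D (enum_val i))%:R - (s (b j) == D (enum_val i))%:R).
pose N : 'M[int]_(#|~: R|, k) := \matrix_(i < #|~: R|, j < k)
  ((gend (a j) == enum_val i)%:R - (gend (b j) == enum_val i)%:R).
pose K : 'M[int]_(size Gam, k) := \matrix_(i, j) sigma D0 (nth [::] Gam i) 0 j.
have ba j : m (b j) = a j by rewrite /a (headE Fm' HD0) valm'.
apply: (@square_det_unit_cast _ _ _ (size_map _ _) _ (K *m M^T)).
  move=> i j; rewrite mxE (nth_map [::]); last by rewrite -(size_map (fun W => pi_P P (lift_walk W))).
  rewrite (sigma_pi_P HD HD0 memE vtx_s mateT Fm' vtx_eq).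
    by rewrite mxE; apply: eq_bigr => l _; rewrite !mxE.
  by apply: (allP GamW); rewrite mem_nth // -(size_map (fun W => pi_P P (lift_walk W))).
apply: (@kernel_basis_det #|~: R| n k (size Gam) N).
- apply: inj_row_free => x xN.
  (* A left kernel vector, extended by zero to the roots, is a potential constant along edges of
     [F - E]. It is then constant along all edges of [F], and vanishes. *)
  pose y v : rat := \sum_u x 0 u * (enum_val u == v)%:R.
  have yab j : y (gend (a j)) = y (gend (b j)).
    apply/eqP; rewrite -subr_eq0 -sumrB; apply/eqP.
    have /rowP/(_ j) := xN; rewrite mxE [RHS]mxE => xNj; rewrite -[RHS]xNj.
    apply: eq_bigr => u _.
    by rewrite !mxE rmorphB /= !rmorph_nat -mulrBr ![_ == gend _]eq_sym.
  have y0 v : y v = 0.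
    apply: detR v => [|v vR]; last first.
      rewrite /y big1 // => u _; have := enum_valP u; rewrite inE.
      by case: eqP => [->|]; rewrite ?vR ?mulr0.
    apply: (constant_across_based Fm bE reg) => h hN.
    have [j [hj|hj]] := tail_or_head_index Fm' HD0 (Sub h hN).
      have -> : h = b j by rewrite /b -hj.
      by rewrite ba yab.
    have -> : h = a j by rewrite /a -hj.
    by rewrite -{1}ba (mateK Fm) yab.
  apply/rowP=> u; rewrite mxE -(y0 (enum_val u)) /y (bigD1 u) //= eqxx mulr1.
  rewrite big1 ?addr0 // => w wu; case: eqP; rewrite ?mulr0 //.
  by move/enum_val_inj/eqP; rewrite (negPf wu).
- rewrite (_ : map_mx _ K = sigma_mx D0 Gam) //.
  by apply/matrixP=> i j; rewrite !mxE.
- apply/matrixP=> i u; rewrite mxE [RHS]mxE.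
  have Wi : is_closed_walk (nth [::] Gam i) by apply: (allP GamW); rewrite mem_nth.
  rewrite -[RHS](sigma_circulation Fm' HD0 Wi (enum_val u)).
  by apply: eq_bigr => j _; rewrite [K i j]mxE [N^T j u]mxE [N u j]mxE.
- move=> x xN; suff : is_circulation D0 x.
    apply: (@circulation_ind _ _ Fm' _ HD0 (fun f => exists u, f = u *m K)) => [|W /Gspan[c ->]|f g [u ->] [v ->]].
    + by exists 0; rewrite mul0mx.
    + exists (\row_i c i); rewrite mulmx_sum_row; apply: eq_bigr => i _.
      rewrite mxE; congr (_ *: _); apply/rowP=> j; by rewrite [RHS]mxE [RHS]mxE.
    by exists (u + v); rewrite mulmxDl.
  (* The excess [c] vanishes off the roots by hypothesis. It sums to zero over each component, which
     contains at most one root, so it vanishes at the roots too. *)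
  pose c v : int := \sum_j x 0 j * ((gend (a j) == v)%:R - (gend (b j) == v)%:R).
  have cU v : v \notin R -> c v = 0.
    rewrite -in_setC => vU; have /rowP/(_ (enum_rank_in vU v)) := xN.
    rewrite mxE [RHS]mxE => xNv; rewrite -[RHS]xNv; apply: eq_bigr => j _.
    by rewrite !mxE enum_rankK_in.
  move=> v; change (c v = 0); have [vR|] := boolP (v \in R); last exact: cU.
  pose C := [set w | connect (@adj F) v w].
  have sumC : \sum_(w in C) c w = 0.
    rewrite exchange_big /= big1 // => j _; rewrite -mulr_sumr sumrB.
    have ind w0 : \sum_(w in C) (w0 == w)%:R = (w0 \in C)%:R :> int.
      rewrite big_mkcond (bigD1 w0) //= eqxx big1 ?addr0 => [|w].
        by case: ifP.
      by rewrite eq_sym => /negPf->; case: ifP.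
    rewrite !ind (_ : (gend (a j) \in C) = (gend (b j) \in C)) ?subrr ?mulr0 //.
    rewrite !inE -ba; apply/idP/idP => cc; apply: connect_trans cc (connect1 _).
      by have := adj_mate Fm (m (b j)); rewrite (mateK Fm).
    exact: adj_mate.
  rewrite -sumC (bigD1 v) ?inE ?connect0 //= big1 ?addr0 // => w.
  rewrite inE => /andP[cvw wv]; apply: cU; apply: contra wv => wR.
  by rewrite (rootR v w).
- move=> t; rewrite (_ : colsub t N = \matrix_(i, j) ((enum_val i == gend (a (t j)))%:R
      - (enum_val i == gend (b (t j)))%:R)).
    exact: det_network enum_val_inj.
  by apply/matrixP=> i j; rewrite !mxE ![gend _ == _]eq_sym.
- by move=> t; apply: (resolution_matrix_tu HD) vtx_s mateT vtx_eq surj.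
(* Both sides equal twice the number of vertices minus the number of edges in [E]. *)
rewrite /n /k cardT card_gedge.
have := card_minus_edges Fm sE; have := card_four_regular reg.
have := cardsC R; rewrite cardR; lia.
Qed.
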